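(* Let $(J_1,\mathcal{B}_1)$ and $(J_2,\mathcal{B}_2)$ be standard Borel spaces, let $\alpha\in\mathcal{M}_+(\mathcal{B}_1)$ and $\beta\in\mathcal{M}_+(\mathcal{B}_2)$ with $\alpha(J_1)=\beta(J_2)$, and let $\psi\in\mathcal{M}_+((\mathcal{B}_1\oplus\mathcal{B}_2)^2)$ be supported on $J_1\times J_2$. Let $E\subseteq J_1\times J_2$ be a measurable bipartite graph, i.e. a Borel set such that for every $S\in\mathcal{B}_1$ the set $$N(S):=\{y\in J_2:\ \exists x\in S,\ (x,y)\in E\}$$ belongs to $\mathcal{B}_2$. Assume that $\psi$ is supported on $E$, and that for every $S_1\in\mathcal{B}_1$ and every $S_2\in\mathcal{B}_2$ with $S_2\subseteq N(S_1)$ one has $\psi(S_1\times S_2)\ge\beta(S_2)$. Then there exists a feasible $\alpha$-$\beta$ transshipment (with capacity $\psi$) if and only if $$\alpha(S)\le\beta(N(S))\qquad\text{for all }S\in\mathcal{B}_1.$$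
   Context: $\mathcal{M}_+(\cdot)$ denotes finite nonnegative measures. $J_1\sqcup J_2$ is regarded as a disjoint union, with $\sigma$-algebra $\mathcal{B}_1\oplus\mathcal{B}_2=\{A_1\sqcup A_2: A_i\in\mathcal{B}_i\}$, and $(\mathcal{B}_1\oplus\mathcal{B}_2)^2$ is the product $\sigma$-algebra on $(J_1\sqcup J_2)\times(J_1\sqcup J_2)$. A measure is supported on a measurable set $S$ if the complement of $S$ has measure zero. $\mu\le\nu$ means $\nu-\mu$ is a nonnegative measure. A feasible $\alpha$-$\beta$ transshipment is a measure $\mu$ on $(J_1\sqcup J_2)\times(J_1\sqcup J_2)$ with $0\le\mu\le\psi$ whose marginals are $\mu(X\times(J_1\sqcup J_2))=\alpha(X\cap J_1)$ and $\mu((J_1\sqcup J_2)\times X)=\beta(X\cap J_2)$ for all $X\in\mathcal{B}_1\oplus\mathcal{B}_2$. *)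

(* Defs.v *)
From HB Require Import structures.
From mathcomp Require Import all_boot all_order all_algebra.
From mathcomp Require Import all_classical all_reals all_analysis.

Set Implicit Arguments.
Unset Strict Implicit.
Unset Printing Implicit Defensive.

Import Order.TTheory GRing.Theory Num.Theory.
Import numFieldNormedType.Exports.

Local Open Scope classical_set_scope.
Local Open Scope ring_scope.

Definition separable (T : topologicalType) : Prop :=
  exists D : set T, countable D /\ dense D.

Definition complete_metric (R : realType) (M : metricType R) : Prop :=
  forall F : set_system M, ProperFilter F -> cauchy F -> exists x : M, F --> x.

(* The measurable sets of [T] are the Borel sets of a separable complete metric
   on [T]; the metric is carried by a type [M] in bijection with [T], since the
   library attaches a metric structure to a type. A [measurableType] is
   inhabited, so the empty space is not covered. *)
Definition standard_borel (R : realType) (d : measure_display)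
    (T : measurableType d) : Prop :=
  exists (M : metricType R) (f : M -> T),
    [/\ complete_metric M, separable M, bijective f &
        forall A : set T, measurable A <-> <<s @open M >> (f @^-1` A)].

Definition measure_sum_display :
  (measure_display * measure_display) -> measure_display.
Proof. exact. Qed.

Section sum_sigma_algebra.
Context (d1 d2 : measure_display).
Context (T1 : measurableType d1) (T2 : measurableType d2).

Definition sum_measurable : set (set (T1 + T2)%type) :=
  [set inl @` A1 `|` inr @` A2 | A1 in measurable & A2 in measurable].

Lemma sum_measurableP (A : set (T1 + T2)%type) : sum_measurable A <->
  measurable (inl @^-1` A) /\ measurable (inr @^-1` A).
Proof.
split=> [[A1 mA1 [A2 mA2 <-]]|[m1 m2]].
  have -> : inl @^-1` (inl @` A1 `|` inr @` A2) = A1.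
    apply/seteqP; split=> [x /= [[y A1y [<-]]//|[y _ //]]|x A1x].
    by left; exists x.
  have -> : inr @^-1` (inl @` A1 `|` inr @` A2) = A2.
    apply/seteqP; split=> [x /= [[y _ //]|[y A2y [<-]]//]|x A2x].
    by right; exists x.
  by [].
exists (inl @^-1` A) => //; exists (inr @^-1` A) => //.
apply/seteqP; split=> [x [[y Ay <-]//|[y Ay <-]//]|[x Ax|x Ax]].
- by left; exists x.
- by right; exists x.
Qed.

Let sum_measurable0 : sum_measurable set0.
Proof. by apply/sum_measurableP; rewrite !preimage_set0. Qed.

Let sum_measurableC A : sum_measurable A -> sum_measurable (~` A).
Proof.
move=> /sum_measurableP[m1 m2]; apply/sum_measurableP.
by split; apply: measurableC.
Qed.

Let sum_measurable_bigcup (F : (set (T1 + T2)%type)^nat) :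
  (forall i, sum_measurable (F i)) -> sum_measurable (\bigcup_i F i).
Proof.
move=> mF; apply/sum_measurableP.
by split; rewrite preimage_bigcup; apply: bigcupT_measurable => i;
  have /sum_measurableP[] := mF i.
Qed.

HB.instance Definition _ :=
  isPointed.Build (T1 + T2)%type (inl (point : T1)).
HB.instance Definition _ :=
  @isMeasurable.Build (measure_sum_display (d1, d2)) (T1 + T2)%type
    sum_measurable sum_measurable0 sum_measurableC sum_measurable_bigcup.

End sum_sigma_algebra.

Section transshipment.
Context (R : realType) (d1 d2 : measure_display).
Context (J1 : measurableType d1) (J2 : measurableType d2).

Local Open Scope ereal_scope.

Definition supported_on (d : measure_display) (T : measurableType d)
  (mu : set T -> \bar R) (S : set T) : Prop := mu (~` S) = 0.

Definition measure_le (d : measure_display) (T : measurableType d)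
    (mu nu : set T -> \bar R) : Prop :=
  exists delta : {measure set T -> \bar R},
    forall A, measurable A -> delta A = nu A - mu A.

(* The inclusion of J1 x J2 into the square of the disjoint union. *)
Definition sum_pair (p : J1 * J2) : (J1 + J2) * (J1 + J2) :=
  (inl p.1, inr p.2).

Lemma measurable_sum_pair (E : set (J1 * J2)) :
  measurable E -> measurable (sum_pair @` E).
Proof.
pose g (p : (J1 + J2) * (J1 + J2)) : J1 * J2 :=
  (if p.1 is inl x then x else point, if p.2 is inr y then y else point).
have minl : measurable (range (@inl J1 J2)).
  apply/sum_measurableP; split.
    by rewrite (_ : _ @^-1` _ = setT)//; apply/seteqP; split=> // x _; exists x.
  by rewrite (_ : _ @^-1` _ = set0)//; apply/seteqP; split=> // x [].
have minr : measurable (range (@inr J1 J2)).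
  apply/sum_measurableP; split.
    by rewrite (_ : _ @^-1` _ = set0)//; apply/seteqP; split=> // x [].
  by rewrite (_ : _ @^-1` _ = setT)//; apply/seteqP; split=> // x _; exists x.
have mu1 : measurable_fun setT
    (fun s : J1 + J2 => if s is inl x then x else point).
  move=> _ Y mY; rewrite setTI; apply/sum_measurableP; split; first exact: mY.
  have mc : measurable_fun setT (fun _ : J2 => point : J1).
    exact: measurable_cst.
  by have := mc measurableT _ mY; rewrite setTI.
have mu2 : measurable_fun setT
    (fun s : J1 + J2 => if s is inr y then y else point).
  move=> _ Y mY; rewrite setTI; apply/sum_measurableP; split; last exact: mY.
  have mc : measurable_fun setT (fun _ : J1 => point : J2).
    exact: measurable_cst.
  by have := mc measurableT _ mY; rewrite setTI.
have mg : measurable_fun setT g.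
  apply: measurable_fun_pair.
    exact: (measurableT_comp mu1 measurable_fst).
  exact: (measurableT_comp mu2 measurable_snd).
move=> mE.
rewrite (_ : _ @` _ = (range inl `*` range inr) `&` (g @^-1` E)).
  apply: measurableI; first exact: measurableX.
  by rewrite -[X in measurable X]setTI; exact: mg.
apply/seteqP; split=> [_ [[x y] Exy <-]|[_ _] [/= [[x _ <-] [y _ <-]] Exy]].
  by split => //=; split; [exists x|exists y].
by exists (x, y).
Qed.

Definition feasible_transshipment (alpha : set J1 -> \bar R)
    (beta : set J2 -> \bar R)
    (psi : set ((J1 + J2) * (J1 + J2))%type -> \bar R)
    (mu : {measure set ((J1 + J2) * (J1 + J2))%type -> \bar R}) : Prop :=
  [/\ measure_le mu psi,
      forall X : set (J1 + J2)%type, measurable X ->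
        mu (X `*` setT) = alpha (inl @^-1` X) &
      forall X : set (J1 + J2)%type, measurable X ->
        mu (setT `*` X) = beta (inr @^-1` X)].

Definition neighbors (E : set (J1 * J2)) (S : set J1) : set J2 :=
  [set y | exists x, S x /\ E (x, y)].

Definition measurable_bipartite_graph (E : set (J1 * J2)) : Prop :=
  measurable E /\
  forall S : set J1, measurable S -> measurable (neighbors E S).

End transshipment.

(* Main.v *)
Require Import Defs.
From HB Require Import structures.
From mathcomp Require Import all_boot all_order all_algebra.
From mathcomp Require Import all_classical all_reals all_analysis.

(** Finite partitions reduce the problem to a transportation problem, and
  domination by the finite measure psi makes the passage to the limit free.

  Necessity is the easy half of Hall's theorem: a transshipment mu below psi
  lives on E, so the mass alpha S that leaves S arrives in N(S), which receives
  beta (N(S)) in total ([coupling_hall]).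

  For sufficiency, cut the left space into finitely many measurable pieces A_i,
  and the right space into pieces B_k fine enough that every N(A_i) is a union
  of them. Join i to k when B_k is contained in N(A_i). Hall's condition for E
  becomes Hall's condition for this finite bipartite graph with weights
  alpha A_i and beta B_k, so a fractional transport x exists
  ([exists_transport]). The capacities take care of themselves:
  x_ik <= beta B_k <= psi (A_i x B_k) on every edge, by the assumption that
  psi (S1 x S2) >= beta S2 whenever S2 is contained in N(S1). Giving psi the
  density x_ik / psi (A_i x B_k) on A_i x B_k produces a set function below psi
  whose marginals are right on all unions of pieces ([finite_transport]).

  The set functions that are additive and bounded by psi form a compact set for
  pointwise convergence, so one of them has the right marginals on all
  measurable sets at once ([sub_content_compact]). Such a limit is only finitely
  additive a priori, but it is countably additive because it is dominated by the
  finite measure psi: the tails of a disjoint union have psi-mass tending to 0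
  ([measure_of_sub_content]). The same applies to the difference with psi, which
  is the measure that witnesses mu <= psi.

  Alpha and beta live on the two summands of the disjoint union; pushing them
  forward along the injections puts everything on the same space, so the
  argument is carried out for two arbitrary measurable spaces. *)

Set Implicit Arguments.
Unset Strict Implicit.
Unset Printing Implicit Defensive.

Import Order.TTheory GRing.Theory Num.Theory.
Import numFieldNormedType.Exports.

Local Open Scope ring_scope.

(** * Fractional transport in finite bipartite graphs *)

Section fractional_hall.
Import mathcomp.boot.fintype mathcomp.boot.finset.
Variables (R : realFieldType) (I K : finType) (e : I -> K -> bool).
Implicit Types (a : I -> R) (b : K -> R) (T : {set I}).

Definition nbhd T : {set K} := [set k | [exists i in T, e i k]].

Definition hall a b := forall T, \sum_(i in T) a i <= \sum_(k in nbhd T) b k.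

Definition transport a b (x : I -> K -> R) :=
  [/\ forall i k, 0 <= x i k, forall i k, ~~ e i k -> x i k = 0,
      forall i, \sum_k x i k = a i & forall k, \sum_i x i k <= b k].

Lemma nbhdU T1 T2 : nbhd (T1 :|: T2) = nbhd T1 :|: nbhd T2.
Proof.
apply/setP => k; rewrite !inE; apply/exists_inP/orP.
  by case=> i; rewrite inE => /orP[] iT eik; [left|right];
    apply/exists_inP; exists i.
by case=> /exists_inP[i iT eik]; exists i => //; rewrite inE iT ?orbT.
Qed.

Lemma transportD a1 b1 x1 a2 b2 x2 : transport a1 b1 x1 -> transport a2 b2 x2 ->
  transport (fun i => a1 i + a2 i) (fun k => b1 k + b2 k)
    (fun i k => x1 i k + x2 i k).
Proof.
move=> [p1 s1 r1 c1] [p2 s2 r2 c2]; split=> [i k|i k nik|i|k].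
- exact: addr_ge0.
- by rewrite s1 ?s2 ?addr0.
- by rewrite big_split /= r1 r2.
- by rewrite big_split /= lerD.
Qed.

Lemma eq_transport a a' b b' x : a =1 a' -> b =1 b' -> transport a b x ->
  transport a' b' x.
Proof.
by move=> aE bE [p s r c]; split=> // [i|k]; rewrite -?aE -?bE.
Qed.

Lemma transport_delta i0 k0 (t : R) : 0 <= t -> e i0 k0 ->
  transport (fun i => t *+ (i == i0)) (fun k => t *+ (k == k0))
    (fun i k => t *+ ((i == i0) && (k == k0))).
Proof.
move=> t0 e0; split=> [i k|i k|i|k].
- by rewrite mulrn_wge0.
- by case: eqP => [->|//]; case: eqP => [->|//]; rewrite e0.
- rewrite (bigD1 k0) //= big1 => [|k /negPf ->]; last by rewrite andbF.
  by rewrite eqxx andbT addr0.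
- rewrite (bigD1 i0) //= big1 => [|i /negPf -> //].
  by rewrite eqxx addr0.
Qed.

Definition restr (L : finType) (S : {set L}) (f : L -> R) l :=
  if l \in S then f l else 0.

Lemma sum_restr (L : finType) (S P : {set L}) f :
  \sum_(l in P) restr S f l = \sum_(l in P :&: S) f l.
Proof. by rewrite -big_mkcondr; apply: eq_bigl => l; rewrite inE. Qed.

Lemma sumsetID (L : finType) (S P : {set L}) (f : L -> R) :
  \sum_(l in P) f l = \sum_(l in P :&: S) f l + \sum_(l in P :\: S) f l.
Proof. exact: big_setID. Qed.

Lemma le_sumset (L : finType) (S P : {set L}) (f : L -> R) :
  (forall l, 0 <= f l) -> S \subset P -> \sum_(l in S) f l <= \sum_(l in P) f l.
Proof.
move=> f0 /setIidPr SP; rewrite (sumsetID S P) SP lerDl.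
by apply: sumr_ge0.
Qed.

(** With [hall_contract], splits an instance along a tight set [T], one whose
  neighborhood has no mass to spare: [T] and [nbhd T] form one instance, and
  their complements the other. Restricting keeps the condition because the
  neighbors of a part of [T] are already in [nbhd T]. *)
Lemma hall_restr a b T : (forall k, 0 <= b k) -> hall a b ->
  hall (restr T a) (restr (nbhd T) b).
Proof.
move=> b0 ab S; rewrite !sum_restr; apply: le_trans (ab _) _.
apply: le_sumset => //; apply/subsetP => k; rewrite !inE.
move=> /exists_inP[i]; rewrite inE => /andP[iS iT] eik.
by apply/andP; split; apply/exists_inP; exists i.
Qed.

(** Outside [T] the condition for [S] is the condition for [S :|: T] from which
  the equality for [T] is subtracted. *)
Lemma hall_contract a b T : hall a b ->
  \sum_(i in T) a i = \sum_(k in nbhd T) b k ->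
  hall (restr (~: T) a) (restr (~: nbhd T) b).
Proof.
move=> ab tT S; rewrite !sum_restr.
have := ab (S :|: T); rewrite nbhdU.
rewrite (sumsetID T) (sumsetID (nbhd T) (_ :|: _)).
rewrite ![(_ :|: _) :&: _]setIC !setKU tT lerD2l.
by rewrite !setDUl !setDv !setU0 !setDE.
Qed.

Definition supp (L : finType) (f : L -> R) := [set l | f l != 0].

Lemma supp_restr (L : finType) (S : {set L}) f :
  supp (restr S f) \subset supp f.
Proof.
by apply/subsetP => l; rewrite !inE /restr; case: ifP; rewrite ?eqxx.
Qed.

Lemma suppS (L : finType) (f g : L -> R) l : supp f \subset supp g ->
  f l = 0 -> g l != 0 -> (#|supp f| < #|supp g|)%N.
Proof.
move=> fg fl gl; apply: proper_card; apply/properP; split => //.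
by exists l; rewrite !inE ?fl ?eqxx.
Qed.

(** Fractional Hall theorem, by induction on the number of vertices of nonzero
  weight. Send along some edge between two such vertices the largest amount that
  keeps the condition. What stops it is either an exhausted endpoint, which
  leaves fewer vertices, or a set [T] that becomes tight and separates the two
  endpoints; the two halves given by [hall_restr] and [hall_contract] then each
  lack one endpoint. *)
Lemma exists_transport a b : (forall i, 0 <= a i) -> (forall k, 0 <= b k) ->
  hall a b -> exists x, transport a b x.
Proof.
have [n] := ubnP (#|supp a| + #|supp b|)%N.
elim: n a b => // n IH a b; rewrite ltnS => ub a0 b0 ab.
have [sa0|[i0]] := set_0Vmem (supp a).
  exists (fun _ _ => 0); split=> // [i|k]; rewrite big1 //.
  by apply/esym/eqP; apply: contraFT (in_set0 i); rewrite -sa0 inE.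
rewrite inE => ai0.
have [k0 /andP[eik bk0]] : exists k, e i0 k && (b k != 0).
  apply/existsP; apply: contraT; rewrite negb_exists => /forallP h.
  have := ab [set i0]; rewrite big_set1 big1 => [|k].
    by rewrite leNgt lt0r ai0 a0.
  rewrite inE => /exists_inP[i]; rewrite inE => /eqP -> eik.
  by have := h k; rewrite eik /= negbK => /eqP.
have ai0p : 0 < a i0 by rewrite lt0r ai0 a0.
have bk0p : 0 < b k0 by rewrite lt0r bk0 b0.
(* Sending t over the edge lowers both sides of the condition for T by t, or
   neither side, except when T is touched: it then costs t of the slack. *)
pose slack T := \sum_(k in nbhd T) b k - \sum_(i in T) a i.
pose touched T := (i0 \notin T) && (k0 \in nbhd T).
pose eps0 := Num.min (a i0) (b k0).
pose eps := \big[Num.min/eps0]_(T | touched T) slack T.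
have eps_ge0 : 0 <= eps.
  rewrite /eps; elim/big_ind: _ => [|x y x0 y0|T _].
  - by rewrite /eps0 le_min a0 b0.
  - by rewrite le_min x0 y0.
  - by rewrite subr_ge0 ab.
have eps_le0 : eps <= eps0 by exact: bigmin_le_id.
have [eps_a eps_b] : eps <= a i0 /\ eps <= b k0.
  by move: eps_le0; rewrite le_min => /andP.
have eps_slack T : touched T -> eps <= slack T.
  by move=> tT; exact: bigmin_le_cond.
pose a' i := a i - eps *+ (i == i0).
pose b' k := b k - eps *+ (k == k0).
have a'0 i : 0 <= a' i.
  by rewrite /a' subr_ge0; case: eqP => [->|_]; rewrite ?mulr1n ?mulr0n.
have b'0 k : 0 <= b' k.
  by rewrite /b' subr_ge0; case: eqP => [->|_]; rewrite ?mulr1n ?mulr0n.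
have sum_a' T : \sum_(i in T) a' i = \sum_(i in T) a i - eps *+ (i0 \in T).
  rewrite sumrB; congr (_ - _); case: (boolP (i0 \in T)) => iT.
    rewrite (bigD1 i0) //= eqxx big1 ?addr0 // => i /andP[_ /negPf ->] //.
  by rewrite big1 // => i iT'; case: eqP => // ii; rewrite -ii iT' in iT.
have sum_b' S : \sum_(k in S) b' k = \sum_(k in S) b k - eps *+ (k0 \in S).
  rewrite sumrB; congr (_ - _); case: (boolP (k0 \in S)) => kS.
    rewrite (bigD1 k0) //= eqxx big1 ?addr0 // => k /andP[_ /negPf ->] //.
  by rewrite big1 // => k kS'; case: eqP => // kk; rewrite -kk kS' in kS.
have ab' : hall a' b'.
  move=> T; rewrite sum_a' sum_b'; have abT := ab T.
  case: (boolP (i0 \in T)) => iT.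
    have -> : k0 \in nbhd T by rewrite inE; apply/exists_inP; exists i0.
    by rewrite lerD2r.
  case: (boolP (k0 \in nbhd T)) => kT; last by rewrite !subr0.
  have := eps_slack T; rewrite /touched /slack iT kT => /(_ isT) h.
  by rewrite mulr1n mulr0n subr0 lerBrDr addrC -lerBrDr.
have sa : supp a' \subset supp a.
  apply/subsetP => i; rewrite !inE /a'; case: (eqVneq i i0) => [-> //|_].
  by rewrite mulr0n subr0.
have sb : supp b' \subset supp b.
  apply/subsetP => k; rewrite !inE /b'; case: (eqVneq k k0) => [-> //|_].
  by rewrite mulr0n subr0.
suff [x' tx'] : exists x', transport a' b' x'.
  exists (fun i k => eps *+ ((i == i0) && (k == k0)) + x' i k).
  apply: eq_transport (transportD (transport_delta eps_ge0 eik) tx').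
    by move=> i; rewrite /a' addrC subrK.
  by move=> k; rewrite /b' addrC subrK.
have [a'i0|a'i0] := eqVneq (a' i0) 0.
  apply: IH => //; apply: leq_trans ub; rewrite -addSn leq_add //.
    exact: suppS a'i0 ai0.
  exact: subset_leq_card.
have [b'k0|b'k0] := eqVneq (b' k0) 0.
  apply: IH => //; apply: leq_trans ub; rewrite -addnS leq_add //.
    exact: subset_leq_card.
  exact: suppS b'k0 bk0.
have [T tT epsT] : exists2 T, touched T & eps = slack T.
  have : eps = eps0 \/ exists2 T, touched T & eps = slack T.
    rewrite /eps; elim/big_ind: _ => [|x y hx hy|T tT]; first by left.
      by case: (leP x y).
    by right; exists T.
  case=> // epsE; exfalso; move: a'i0 b'k0; rewrite /a' /b' !eqxx !mulr1n epsE.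
  by rewrite /eps0; case: leP; rewrite subrr eqxx.
have /andP[iT kT] := tT.
have tight : \sum_(i in T) a' i = \sum_(k in nbhd T) b' k.
  rewrite sum_a' sum_b' (negPf iT) kT mulr1n mulr0n subr0 epsT /slack.
  by rewrite opprB addrC subrK.
have [||||x1 t1] := IH (restr T a') (restr (nbhd T) b').
- apply: leq_trans ub; rewrite -addSn leq_add //.
    apply: (@suppS _ _ _ i0) => //.
      exact: subset_trans (supp_restr _ _) sa.
    by rewrite /restr (negPf iT).
  exact/subset_leq_card/(subset_trans (supp_restr _ _)).
- by move=> i; rewrite /restr; case: ifP.
- by move=> k; rewrite /restr; case: ifP.
- exact: hall_restr.
have [||||x2 t2] := IH (restr (~: T) a') (restr (~: nbhd T) b').
- apply: leq_trans ub; rewrite -addnS leq_add //.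
    exact/subset_leq_card/(subset_trans (supp_restr _ _)).
  apply: (@suppS _ _ _ k0) => //.
    exact: subset_trans (supp_restr _ _) sb.
  by rewrite /restr inE kT.
- by move=> i; rewrite /restr; case: ifP.
- by move=> k; rewrite /restr; case: ifP.
- exact: hall_contract.
exists (fun i k => x1 i k + x2 i k); apply: eq_transport (transportD t1 t2).
  by move=> i; rewrite /restr inE; case: ifP; rewrite ?addr0 ?add0r.
by move=> k; rewrite /restr in_setC; case: ifP; rewrite ?addr0 ?add0r.
Qed.

End fractional_hall.

Local Open Scope classical_set_scope.

(** * Additive set functions dominated by a finite measure *)

Section sub_content.
Context (R : realType) (d : measure_display) (T : measurableType d).
Implicit Types (l : set T -> R) (psi mu : {measure set T -> \bar R}).

Definition set_additive l := forall A B, measurable A -> measurable B ->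
  A `&` B = set0 -> l (A `|` B) = l A + l B.

(** Positivity is asked of all sets, measurable or not, because a measure is
  nonnegative on every set. *)
Definition sub_content psi l :=
  [/\ forall A, 0 <= l A, set_additive l &
      forall A, measurable A -> l A <= fine (psi A)].

Lemma measure_finite psi A : (psi setT < +oo)%E -> measurable A ->
  psi A \is a fin_num.
Proof.
move=> psioo mA; rewrite ge0_fin_numE ?measure_ge0//.
by apply: le_lt_trans psioo; apply: le_measure; rewrite ?inE.
Qed.

Lemma fine_additive psi : (psi setT < +oo)%E ->
  set_additive (fun A => fine (psi A)).
Proof.
move=> psioo A B mA mB AB0 /=.
by rewrite measureU// fineD// measure_finite.
Qed.

Lemma set_additive0 l : set_additive l -> l set0 = 0.
Proof.
move=> /(_ _ _ measurable0 measurable0 (setI0 _)); rewrite setU0.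
by move=> /eqP; rewrite -subr_eq0 opprD addNKr oppr_eq0 => /eqP.
Qed.

Lemma set_additive_bigcup l (F : (set T)^nat) n : set_additive l ->
  (forall i, measurable (F i)) -> trivIset setT F ->
  l (\bigcup_i F i) =
    \sum_(i < n) l (F i) + l (\bigcup_i F (n + i)%N).
Proof.
move=> addl mF tF; elim: n => [|n ->]; first by rewrite big_ord0 add0r.
rewrite big_ord_recr /= -addrA; congr +%R.
have -> : \bigcup_i F (n + i)%N = F n `|` \bigcup_i F (n.+1 + i)%N.
  apply/seteqP; split=> [x [[|i] _]|x [Fn|[i _ Fi]]].
  - by rewrite addn0; left.
  - by rewrite addnS -addSn; right; exists i.
  - by exists 0%N; rewrite ?addn0.
  - by exists i.+1; rewrite ?addnS.
apply: addl => //; first exact: bigcupT_measurable.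
rewrite -subset0 => x [Fn [i _ Fi]].
have /eqP := tF _ _ I I (ex_intro _ x (conj Fn Fi)).
by rewrite addSn -addnS -[X in X == _]addn0 eqn_add2l.
Qed.

(** Countable additivity is automatic: the tail unions of a disjoint sequence
  decrease to the empty set, so their psi-mass, and hence their [l]-mass, tends
  to 0. *)
Lemma measure_of_sub_content psi l : (psi setT < +oo)%E -> sub_content psi l ->
  exists mu, forall A, measurable A -> mu A = (l A)%:E.
Proof.
move=> psioo [l0 addl lpsi].
pose m A := (l A)%:E.
have m0 : m set0 = 0%E by rewrite /m set_additive0.
have mge0 A : (0 <= m A)%E by rewrite lee_fin.
have msig : semi_sigma_additive m.
  move=> F mF tF mU.
  pose G n := \bigcup_i F (n + i)%N.
  have mG n : measurable (G n) by exact: bigcupT_measurable.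
  have psiG : (fine \o (psi \o G)) @ \oo --> 0.
    apply: fine_cvg.
    have capG : \bigcap_n G n = set0.
      rewrite -subset0 => x Gx; have [i _ Fi] := Gx 0%N I.
      have [j _ Fj] := Gx i.+1 I.
      have := tF _ _ I I (ex_intro _ x (conj Fi Fj)).
      rewrite add0n addSn => /eqP.
      by rewrite -[X in X == _]addn0 -addnS eqn_add2l.
    rewrite (_ : 0%:E = psi (\bigcap_n G n)); last by rewrite capG measure0.
    apply: nonincreasing_cvg_mu => //.
    - by rewrite (le_lt_trans _ psioo)// le_measure ?inE.
    - by rewrite capG.
    - move=> i j ij; apply/subsetPset => x [k _ Fk]; exists (j - i + k)%N => //.
      by rewrite addnA subnKC.
  have lG : (l \o G) @ \oo --> 0.
    apply: (squeeze_cvgr _ (cvg_cst 0) psiG).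
    by apply: nearW => n /=; rewrite l0 lpsi.
  rewrite (_ : (fun n => _) = EFin \o (fun n => l (\bigcup_i F i) - l (G n))).
    apply: cvg_EFin; first exact: nearW.
    rewrite -[X in _ --> X]subr0.
    by apply: cvgB => //; exact: cvg_cst.
  apply/funext => n /=; rewrite big_mkord /m sumEFin.
  by rewrite (set_additive_bigcup n addl mF tF) addrK.
pose HBm := isMeasure.Build _ _ _ m m0 mge0 msig.
pose mu : {measure set T -> \bar R} := HB.pack m HBm.
by exists mu.
Qed.

(** The class is stable under complement in [psi]: [measure_of_sub_content] also
  turns the difference into a measure, as [measure_le] requires. *)
Lemma sub_content_compl psi l : (psi setT < +oo)%E -> sub_content psi l ->
  sub_content psi
    (fun A => if `[< measurable A >] then fine (psi A) - l A else 0).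
Proof.
move=> psioo [l0 addl lpsi]; split=> [A|A B mA mB AB|A mA].
- by case: asboolP => // mA; rewrite subr_ge0 lpsi.
- rewrite !asboolT//; last exact: measurableU.
  by rewrite addl// fine_additive// opprD addrACA.
- by rewrite asboolT// gerBl.
Qed.

Lemma sub_content_measure psi l : (psi setT < +oo)%E -> sub_content psi l ->
  exists mu, measure_le mu psi /\ forall A, measurable A -> mu A = (l A)%:E.
Proof.
move=> psioo lpsi; have [mu muE] := measure_of_sub_content psioo lpsi.
have [delta deltaE] :=
  measure_of_sub_content psioo (sub_content_compl psioo lpsi).
exists mu; split=> //; exists delta => A mA.
by rewrite deltaE// muE// asboolT// EFinB fineK// measure_finite.
Qed.

Lemma measurable_fibers (I : finType) (f : T -> I) (S : {set I}) :
  (forall i, measurable (f @^-1` [set i])) -> measurable (f @^-1` [set` S]).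
Proof.
move=> mf; rewrite (_ : _ @^-1` _ = \bigcup_(i in [set` S]) f @^-1` [set i]).
  by apply: fin_bigcup_measurable => // i _; exact: mf.
apply/seteqP; split=> [x Sx|x [i iS fxi]]; first by exists (f x).
by rewrite /= fxi.
Qed.

Lemma additive_fibers (I : finType) (f : T -> I) l (S : {set I}) :
  set_additive l -> (forall i, measurable (f @^-1` [set i])) ->
  l (f @^-1` [set` S]) = \sum_(i in S) l (f @^-1` [set i]).
Proof.
move=> addl mf; have [n] := ubnP #|S|.
elim: n S => // n IH S; have [->|[i iS]] := set_0Vmem S.
  rewrite finset.big_set0 (_ : _ @^-1` _ = set0) ?set_additive0//.
  by rewrite -subset0 => x /=; rewrite inE.
rewrite (cardsD1 i) iS ltnS => /IH{}IH.
rewrite (big_setD1 i)//= -IH -addl//; first last.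
- by rewrite -subset0 => x [/= fxi]; rewrite /= fxi !inE eqxx.
- exact: measurable_fibers.
congr l; apply/seteqP; split=> x /=.
  by have [->|fxi] := eqVneq (f x) i; [left|right; rewrite !inE fxi].
by case=> [->//|]; rewrite !inE => /andP[].
Qed.

End sub_content.

(** * Compactness *)

Lemma ultra_map (X Y : Type) (f : X -> Y) (U : set_system X) :
  UltraFilter U -> UltraFilter (f @ U).
Proof.
move=> UU; split; first exact: fmap_proper_filter.
move=> G GG sUG; apply/seteqP; split=> // A GA.
have [//|UnA] := in_ultra_setVsetC (f @^-1` A) UU.
have /filter_ex[y []//] : G (A `&` ~` A) by apply: filterI => //; apply: sUG.
Qed.

Section compactness.
Context (R : realType) (d : measure_display) (T : measurableType d).
Implicit Types psi : {measure set T -> \bar R}.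

(** Take the limit, along an ultrafilter containing all the tails
  [[set s | s0 is contained in s]], of solutions for the finite lists of
  constraints. It exists pointwise because the values on [A] stay in
  [[0, psi A]], and every constraint holds eventually. *)
Lemma sub_content_compact psi (X : choiceType) (D : set X) (G : X -> set T)
    (v : X -> R) :
  (forall u, D u -> measurable (G u)) ->
  (forall s : seq X, exists l, sub_content psi l /\
     forall u, u \in s -> D u -> l (G u) = v u) ->
  exists l, sub_content psi l /\ forall u, D u -> l (G u) = v u.
Proof.
move=> mG /choice[L LP].
pose tails := [set P : set (seq X) |
  exists s0 : seq X, forall s : seq X, {subset s0 <= s} -> P s].
have tails_filter : ProperFilter tails.
  split.
    by move=> [s0 /(_ s0)]; exact.
  split.
  - by exists [::].
  - move=> P Q [s1 Ps1] [s2 Qs2]; exists (s1 ++ s2) => s s12.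
    by split; [apply: Ps1|apply: Qs2] => u us; apply: s12;
      rewrite mem_cat us ?orbT.
  - by move=> P Q PQ [s0 Ps0]; exists s0 => s /Ps0/PQ.
have [U [UU tailsU]] := ultraFilterLemma tails_filter.
have limL A : exists r : R, measurable A -> L s A @[s --> U] --> r.
  have [mA|] := pselect (measurable A); last by exists 0.
  have := @segment_compact R 0 (fine (psi A)).
  rewrite compact_ultra => /(_ _ (ultra_map (L^~ A) UU))[].
    apply: (@filterS _ U _ setT); last exact: filterT.
    move=> s _ /=; have [[L0 _ Lpsi] _] := LP s.
    by rewrite in_itv /= L0 Lpsi.
  by move=> r [_ Lr]; exists r.
have {limL}[lim limL] := choice limL.
exists (fun A => if `[< measurable A >] then lim A else 0).
split; first split=> [A|A B mA mB AB|A mA].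
- case: asboolP => // mA; rewrite -(cvg_lim (@Rhausdorff R) (limL A mA)).
  apply: limr_ge; first by apply/cvg_ex; exists (lim A); exact: limL.
  by apply: nearW => s; have [[L0 _ _] _] := LP s.
- have mAB : measurable (A `|` B) by exact: measurableU.
  rewrite !asboolT//.
  apply: (cvg_unique (@Rhausdorff R) (limL _ mAB)).
  rewrite (_ : (fun s => _) = (fun s => L s A + L s B)).
    exact: cvgD (limL _ mA) (limL _ mB).
  by apply/funext => s; have [[_ addL _] _] := LP s; exact: addL.
- rewrite asboolT// -(cvg_lim (@Rhausdorff R) (limL A mA)).
  apply: limr_le; first by apply/cvg_ex; exists (lim A); exact: limL.
  by apply: nearW => s; have [[_ _ Lpsi] _] := LP s; exact: Lpsi.
- move=> u Du; have mGu := mG _ Du; rewrite asboolT//.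
  apply: (cvg_unique (@Rhausdorff R) (limL _ mGu)).
  apply: cvg_near_cst; apply: tailsU; exists [:: u] => s us.
  by have [_] := LP s; apply => //; apply: us; rewrite inE.
Qed.

End compactness.

(** * The finite stage *)

Section finite_classification.
Context (d : measure_display) (T : measurableType d).

(** A finite partition is encoded by the map that sends a point to the label of
  its piece; sets made of pieces are then preimages of sets of labels. *)
Lemma finite_classification (s : seq (set T)) :
  (forall A, A \in s -> measurable A) ->
  exists (I : finType) (f : T -> I), (forall i, measurable (f @^-1` [set i])) /\
    forall A, A \in s -> exists S : {set I}, A = f @^-1` [set` S].
Proof.
elim: s => [_|A s IH ms].
  exists unit, (fun _ => tt); split=> // -[].
  by rewrite (_ : _ @^-1` _ = setT)//; apply/seteqP; split.
have [B Bs|I [f [mf fs]]] := IH; first by apply: ms; rewrite inE Bs orbT.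
have mA : measurable A by apply: ms; rewrite inE eqxx.
exists (I * bool)%type, (fun x => (f x, `[< A x >])); split.
  case=> i b.
  rewrite (_ : _ @^-1` _ = f @^-1` [set i] `&` (if b then A else ~` A)).
    by apply: measurableI => //; case: b => //; exact: measurableC.
  apply/seteqP; split=> x /=.
    by case=> <- <-; split=> //; case: asboolP.
  by case=> <- bx; congr pair; case: b bx => bx;
    [rewrite asboolT|rewrite asboolF].
move=> B; rewrite inE => /predU1P[->|/fs[S ->]].
  exists [set q | q.2]%SET; apply/seteqP; split=> x /=; rewrite inE /=.
    by move=> Ax; rewrite asboolT.
  by move/asboolP.
by exists [set q | q.1 \in S]%SET; apply/seteqP; split=> x /=; rewrite inE.
Qed.

End finite_classification.

Section step_density.
Context (R : realType) (d : measure_display) (T : measurableType d).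
Context (psi : {measure set T -> \bar R}) (psioo : (psi setT < +oo)%E).

(** The set function with density [w i] with respect to [psi] on the piece with
  label [i]. *)
Lemma sub_content_step (I : finType) (h : T -> I) (w : I -> R) :
  (forall i, measurable (h @^-1` [set i])) -> (forall i, 0 <= w i <= 1) ->
  sub_content psi (fun A => \sum_i w i * fine (psi (A `&` h @^-1` [set i]))).
Proof.
move=> mh w01; split=> [A|A B mA mB AB|A mA].
- apply: sumr_ge0 => i _; have /andP[wi _] := w01 i.
  by rewrite mulr_ge0// fine_ge0.
- rewrite -big_split/=; apply: eq_bigr => i _; rewrite -mulrDr; congr (_ * _).
  rewrite setIUl (fine_additive psioo) //; try exact: measurableI.
  by rewrite setIACA AB set0I.
- have addA : set_additive (fun B => fine (psi (A `&` B))).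
    move=> B1 B2 mB1 mB2 B12.
    rewrite setIUr (fine_additive psioo)//; try exact: measurableI.
    by rewrite setIACA B12 setI0.
  have := additive_fibers [set: I]%SET addA mh.
  rewrite (_ : _ @^-1` _ = setT) ?setIT => [->|].
    rewrite [leRHS]big_mkcond; apply: ler_sum => i _; rewrite inE.
    by have /andP[_ wi] := w01 i; rewrite ler_piMl// fine_ge0.
  by apply/seteqP; split=> x //= _; rewrite inE.
Qed.

End step_density.

Section hall_transport.
Context (R : realType) (d1 d2 : measure_display).
Context (T1 : measurableType d1) (T2 : measurableType d2).
Variables (alpha : {measure set T1 -> \bar R}).
Variables (beta : {measure set T2 -> \bar R}).
Variables (psi : {measure set (T1 * T2) -> \bar R}) (E : set (T1 * T2)).

Hypothesis beta_fin : (beta setT < +oo)%E.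
Hypothesis psi_fin : (psi setT < +oo)%E.
Hypothesis alpha_beta : alpha setT = beta setT.
Hypothesis mN : forall S, measurable S -> measurable (neighbors E S).
Hypothesis capacity : forall S1 S2, measurable S1 -> measurable S2 ->
  S2 `<=` neighbors E S1 -> (beta S2 <= psi (S1 `*` S2))%E.

Let le_fine (x y : \bar R) : y \is a fin_num -> (0 <= x <= y)%E ->
  fine x <= fine y.
Proof.
move=> yfin /andP[x0 xy]; apply: fine_le => //.
by rewrite ge0_fin_numE// (le_lt_trans xy)// ltey_eq yfin.
Qed.

(** The exact marginals for finitely many prescribed sets. The pieces on the
  right are refined by the neighborhoods of the pieces on the left, so that each
  is either inside or outside a given neighborhood: this is what turns Hall's
  condition for [E] into Hall's condition for the finite graph [e]. *)
Lemma finite_transport (s1 : seq (set T1)) (s2 : seq (set T2)) :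
  (forall X, X \in s1 -> measurable X) ->
  (forall Y, Y \in s2 -> measurable Y) ->
  (forall S, measurable S -> (alpha S <= beta (neighbors E S))%E) ->
  exists l, [/\ sub_content psi l,
    forall X, X \in s1 -> l (X `*` setT) = fine (alpha X) &
    forall Y, Y \in s2 -> l (setT `*` Y) = fine (beta Y)].
Proof.
move=> ms1 ms2 hallE.
have alpha_fin : (alpha setT < +oo)%E by rewrite alpha_beta.
have [I [f [mf fs1]]] := finite_classification ms1.
pose Nf i := neighbors E (f @^-1` [set i]).
have [|K [g [mg gs2]]] := @finite_classification _ _ (s2 ++ [seq Nf i | i : I]).
  move=> Y; rewrite mem_cat => /orP[/ms2//|/mapP[i _ ->]].
  exact: mN.
pose a i := fine (alpha (f @^-1` [set i])).
pose b k := fine (beta (g @^-1` [set k])).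
pose c i k := fine (psi (f @^-1` [set i] `*` g @^-1` [set k])).
pose e i k := `[< g @^-1` [set k] `<=` Nf i >].
have a0 i : 0 <= a i by exact: fine_ge0.
have b0 k : 0 <= b k by exact: fine_ge0.
have aE (S : {set I}) : fine (alpha (f @^-1` [set` S])) = \sum_(i in S) a i.
  exact: additive_fibers (fine_additive alpha_fin) mf.
have bE (S : {set K}) : fine (beta (g @^-1` [set` S])) = \sum_(k in S) b k.
  exact: additive_fibers (fine_additive beta_fin) mg.
have mfg i k : measurable (f @^-1` [set i] `*` g @^-1` [set k]).
  exact: measurableX.
have bc i k : e i k -> b k <= c i k.
  move=> /asboolP eik; apply: le_fine; first exact: measure_finite.
  by rewrite measure_ge0 capacity.
have hall_ab : hall e a b.
  move=> S; rewrite -aE -bE.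
  have mS : measurable (f @^-1` [set` S]) by exact: measurable_fibers.
  have mNS : measurable (g @^-1` [set` nbhd e S]) by exact: measurable_fibers.
  apply: le_fine; first exact: measure_finite.
  rewrite measure_ge0 (le_trans (hallE _ mS))// le_measure ?inE//.
    exact: mN.
  move=> y [x [/= fxS Exy]].
  have Nfy : Nf (f x) y by exists x.
  have [|S' NfE] := gs2 (Nf (f x)).
    by rewrite mem_cat map_f ?orbT// mem_enum.
  rewrite inE; apply/exists_inP; exists (f x) => //; apply/asboolP => z /= gzy.
  by move: Nfy; rewrite NfE /= gzy.
have [x [x0 xe xa xb]] := exists_transport a0 b0 hall_ab.
(* The transport exhausts alpha, and the total masses agree, so no capacity on
   the right is left unused. *)
have {}xb k : \sum_i x i k = b k.
  have sumb : \sum_k (b k - \sum_i x i k) = 0.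
    rewrite sumrB exchange_big/=.
    under [X in _ - X]eq_bigr do rewrite xa.
    have fT : f @^-1` [set` [set: I]%SET] = setT.
      by apply/seteqP; split=> y //= _; rewrite inE.
    have gT : g @^-1` [set` [set: K]%SET] = setT.
      by apply/seteqP; split=> y //= _; rewrite inE.
    have := bE [set: K]%SET; have := aE [set: I]%SET.
    rewrite fT gT alpha_beta => aT bT; apply/eqP; rewrite subr_eq0; apply/eqP.
    transitivity (\sum_(k in [set: K]%SET) b k).
      by apply: eq_bigl => k'; rewrite inE.
    by rewrite -bT aT; apply: eq_bigl => i; rewrite inE.
  apply/esym/eqP; rewrite -subr_eq0; apply/eqP.
  by apply: (psumr_eq0P _ sumb) => // k' _; rewrite subr_ge0.
have xc i k : x i k <= c i k.
  have [eik|/xe ->] := boolP (e i k); last exact: fine_ge0.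
  apply: le_trans (bc _ _ eik); rewrite -xb (bigD1 i)//= lerDl.
  exact: sumr_ge0.
(* If c i k = 0 then x i k = 0 as well, and the value 0 of the quotient is the
   right one. *)
pose w (q : I * K) := x q.1 q.2 / c q.1 q.2.
have c0 i k : 0 <= c i k by exact: fine_ge0.
have wc i k : w (i, k) * c i k = x i k.
  rewrite /w /=; have [ci0|ci0] := eqVneq (c i k) 0; last by rewrite divfK.
  by rewrite ci0 mulr0; apply/eqP; rewrite eq_le x0 -ci0 xc.
have w01 q : 0 <= w q <= 1.
  rewrite /w divr_ge0//=; have [ci0|ci0] := eqVneq (c q.1 q.2) 0.
    by rewrite ci0 invr0 mulr0.
  by rewrite ler_pdivrMr ?mul1r// lt0r ci0 c0.
pose h (p : T1 * T2) := (f p.1, g p.2).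
have hE i k : h @^-1` [set (i, k)] = f @^-1` [set i] `*` g @^-1` [set k].
  by apply/seteqP; split=> -[y z] /= [fy gz]; rewrite /h /= fy gz.
have mh q : measurable (h @^-1` [set q]) by case: q => i k; rewrite hE.
have := sub_content_step psi_fin mh w01.
set l := (fun _ => _) => lpsi.
have lE C : l C = \sum_i \sum_k
    w (i, k) * fine (psi (C `&` (f @^-1` [set i] `*` g @^-1` [set k]))).
  by rewrite pair_bigA /l; apply: eq_bigr => -[i k] _; rewrite -hE.
exists l; split => // [X|Y] inS.
- have [S ->] := fs1 _ inS; rewrite aE lE [RHS]big_mkcond/=.
  apply: eq_bigr => i _; case: ifPn => iS.
    rewrite -xa; apply: eq_bigr => k _; rewrite -wc; congr (_ * fine (psi _)).
    by apply/setIidPr => -[y z] /= [fyi _]; rewrite fyi.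
  apply: big1 => k _; rewrite (_ : _ `&` _ = set0) ?measure0 ?mulr0//.
  rewrite -subset0 => -[y z] /= [[yS _] [fyi _]].
  by move: iS; rewrite -fyi yS.
- have [|S ->] := gs2 Y; first by rewrite mem_cat inS.
  rewrite bE lE exchange_big [RHS]big_mkcond/=.
  apply: eq_bigr => k _; case: ifPn => kS.
    rewrite -xb; apply: eq_bigr => i _; rewrite -wc; congr (_ * fine (psi _)).
    by apply/setIidPr => -[y z] /= [_ gzk]; rewrite gzk.
  apply: big1 => i _; rewrite (_ : _ `&` _ = set0) ?measure0 ?mulr0//.
  rewrite -subset0 => -[y z] /= [[_ zS] [_ gzk]].
  by move: kS; rewrite -gzk zS.
Qed.

(** * Hall's condition and couplings below a capacity *)

Definition coupling (mu : {measure set (T1 * T2) -> \bar R}) :=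
  (forall X, measurable X -> mu (X `*` setT) = alpha X) /\
  (forall Y, measurable Y -> mu (setT `*` Y) = beta Y).

(** A constraint is a measurable set of either space, with the marginal it
  prescribes; [finite_transport] meets any finite number of them. *)
Lemma exists_coupling :
  (forall S, measurable S -> (alpha S <= beta (neighbors E S))%E) ->
  exists mu : {measure set (T1 * T2) -> \bar R},
    measure_le mu psi /\ coupling mu.
Proof.
move=> hallE.
pose D (u : set T1 + set T2) :=
  match u with inl X => measurable X | inr Y => measurable Y end.
pose G (u : set T1 + set T2) : set (T1 * T2) :=
  match u with inl X => X `*` setT | inr Y => setT `*` Y end.
pose v (u : set T1 + set T2) : R :=
  match u with inl X => fine (alpha X) | inr Y => fine (beta Y) end.
have mG u : D u -> measurable (G u) by case: u => A mA; exact: measurableX.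
have [|l [lpsi lv]] := @sub_content_compact _ _ _ psi _ D G v mG.
  move=> s.
  pose s1 := pmap (fun u : set T1 + set T2 => if u is inl X
    then if `[< measurable X >] then Some X else None else None) s.
  pose s2 := pmap (fun u : set T1 + set T2 => if u is inr Y
    then if `[< measurable Y >] then Some Y else None else None) s.
  have [X|Y|l [lpsi l1 l2]] := @finite_transport s1 s2 _ _ hallE.
  - by rewrite mem_pmap => /mapP[[X'|//] _]; case: asboolP => // mX [->].
  - by rewrite mem_pmap => /mapP[[//|Y'] _]; case: asboolP => // mY [->].
  exists l; split=> // -[X|Y] us mu.
  - apply: l1; rewrite mem_pmap; apply/mapP.
    by exists (inl X) => //; rewrite asboolT.
  - apply: l2; rewrite mem_pmap; apply/mapP.
    by exists (inr Y) => //; rewrite asboolT.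
have [mu [mu_psi muE]] := sub_content_measure psi_fin lpsi.
exists mu; split=> //; split=> [X|Y] mX.
- rewrite muE; last exact: measurableX.
  by rewrite (lv (inl X))// fineK// measure_finite// alpha_beta.
- rewrite muE; last exact: measurableX.
  by rewrite (lv (inr Y))// fineK// measure_finite.
Qed.

Lemma coupling_hall (mu : {measure set (T1 * T2) -> \bar R}) :
  supported_on mu E -> measurable E -> coupling mu ->
  forall S, measurable S -> (alpha S <= beta (neighbors E S))%E.
Proof.
move=> muE mE [mu1 mu2] S mS; rewrite -mu1// -mu2; last exact: mN.
rewrite (measureDI _ (_ : measurable (S `*` setT)) mE); last exact: measurableX.
rewrite [X in (X + _)%E](_ : _ = 0%E).
  rewrite add0e le_measure ?inE//.
  - by apply: measurableI => //; exact: measurableX.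
  - by apply: measurableX => //; exact: mN.
  - by move=> [x y] [[/= Sx _] Exy]; split=> //; exists x.
apply: (@subset_measure0 _ _ _ mu _ (~` E)) => //.
- by apply: measurableD => //; exact: measurableX.
- exact: measurableC.
Qed.

End hall_transport.

(** * Transfer to the disjoint union *)

Section disjoint_union.
Context (d1 d2 : measure_display).
Context (J1 : measurableType d1) (J2 : measurableType d2).

Lemma measurable_inl : measurable_fun setT (@inl J1 J2).
Proof. by move=> _ X /sum_measurableP[mX _]; rewrite setTI. Qed.

Lemma measurable_inr : measurable_fun setT (@inr J1 J2).
Proof. by move=> _ X /sum_measurableP[_ mX]; rewrite setTI. Qed.

Lemma measurable_inl_image (X : set J1) : measurable X ->
  measurable (inl @` X : set (J1 + J2)).
Proof.
move=> mX; exists X => //; exists set0; first exact: measurable0.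
by rewrite image_set0 setU0.
Qed.

Lemma measurable_inr_image (Y : set J2) : measurable Y ->
  measurable (inr @` Y : set (J1 + J2)).
Proof.
move=> mY; exists set0; first exact: measurable0.
by exists Y => //; rewrite image_set0 set0U.
Qed.

Lemma preimage_inl_image (X : set J1) : @inl J1 J2 @^-1` (inl @` X) = X.
Proof. by apply/seteqP; split=> [x [y Xy [<-]]|x Xx] //; exists x. Qed.

Lemma preimage_inr_image (Y : set J2) : @inr J1 J2 @^-1` (inr @` Y) = Y.
Proof. by apply/seteqP; split=> [x [y Yy [<-]]|x Yx] //; exists x. Qed.

Lemma neighbors_sum_pair (E : set (J1 * J2)) (X : set (J1 + J2)) :
  neighbors (@sum_pair _ _ J1 J2 @` E) X = inr @` neighbors E (inl @^-1` X).
Proof.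
apply/seteqP; split.
  move=> y [x [Xx [[u v] /= Euv [ux vy]]]].
  by exists v => //; exists u; rewrite /= ux.
by move=> _ [v [u [Xu Euv]] <-]; exists (inl u); split => //; exists (u, v).
Qed.

End disjoint_union.

Lemma supported_on_le (R : realType) (d : measure_display)
    (T : measurableType d) (mu psi : {measure set T -> \bar R}) (E : set T) :
  measurable E -> measure_le mu psi -> supported_on psi E -> supported_on mu E.
Proof.
move=> mE [delta deltaE] psiE; apply/eqP; rewrite -measure_le0.
have : (0 <= delta (~` E))%E by exact: measure_ge0.
rewrite deltaE; last exact: measurableC.
by rewrite psiE sub0e oppe_ge0.
Qed.

Local Open Scope ereal_scope.

Theorem proposition5p3 (R : realType) (d1 d2 : measure_display)
    (J1 : measurableType d1) (J2 : measurableType d2)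
    (alpha : {finite_measure set J1 -> \bar R})
    (beta : {finite_measure set J2 -> \bar R})
    (psi : {finite_measure set ((J1 + J2) * (J1 + J2))%type -> \bar R})
    (E : set (J1 * J2)%type) :
  standard_borel R J1 ->
  standard_borel R J2 ->
  alpha setT = beta setT ->
  supported_on psi (range inl `*` range inr) ->
  measurable_bipartite_graph E ->
  supported_on psi (@sum_pair _ _ J1 J2 @` E) ->
  (forall (S1 : set J1) (S2 : set J2), measurable S1 -> measurable S2 ->
     S2 `<=` neighbors E S1 ->
     beta S2 <= psi ((inl @` S1) `*` (inr @` S2))) ->
  (exists mu : {measure set ((J1 + J2) * (J1 + J2))%type -> \bar R},
     feasible_transshipment alpha beta psi mu) <->
  (forall S : set J1, measurable S -> alpha S <= beta (neighbors E S)).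
Proof.
move=> _ _ alpha_beta _ [mE mN] psiE capacity.
set E' := (_ @` E) in psiE.
have mE' : measurable E' by exact: measurable_sum_pair.
pose alpha' : {measure set (J1 + J2)%type -> \bar R} :=
  measure_function_pushforward__canonical__measure_function_Measure alpha
    (@measurable_inl _ _ J1 J2).
pose beta' : {measure set (J1 + J2)%type -> \bar R} :=
  measure_function_pushforward__canonical__measure_function_Measure beta
    (@measurable_inr _ _ J1 J2).
have mpinl (X : set (J1 + J2)%type) :
    measurable X -> measurable (inl @^-1` X : set J1).
  by move=> /sum_measurableP[].
have mpinr (X : set (J1 + J2)%type) :
    measurable X -> measurable (inr @^-1` X : set J2).
  by move=> /sum_measurableP[].
have mN' X : measurable X -> measurable (neighbors E' X).
  move=> mX; rewrite neighbors_sum_pair; apply: measurable_inr_image.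
  by apply: mN; exact: mpinl.
have betaN X : beta' (neighbors E' X) = beta (neighbors E (inl @^-1` X)).
  by rewrite neighbors_sum_pair /beta' /= /pushforward preimage_inr_image.
split=> [[mu [mu_psi mu1 mu2]] S mS|hallE].
  have mS' : measurable (inl @` S : set (J1 + J2)%type).
    exact: measurable_inl_image.
  have := @coupling_hall _ _ _ _ _ alpha' beta' _ mN' mu
    (supported_on_le mE' mu_psi psiE) mE' (conj mu1 mu2) _ mS'.
  rewrite betaN preimage_inl_image /alpha' /= /pushforward.
  by rewrite preimage_inl_image.
have [|||||X mX|mu [mu_psi [mu1 mu2]]] :=
    @exists_coupling _ _ _ _ _ alpha' beta' psi E'.
- by rewrite /beta' /= /pushforward preimage_setT ltey_eq fin_num_measure.
- by rewrite ltey_eq fin_num_measure.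
- exact: alpha_beta.
- exact: mN'.
- move=> S1 S2 mS1 mS2 S2N.
  have S2N' : inr @^-1` S2 `<=` neighbors E (inl @^-1` S1).
    move=> y /S2N; rewrite neighbors_sum_pair => -[z zN [<-]]; exact: zN.
  apply: le_trans (capacity _ _ (mpinl _ mS1) (mpinr _ mS2) S2N') _.
  apply: le_measure; rewrite ?inE.
  + apply: measurableX; first by apply: measurable_inl_image; exact: mpinl.
    by apply: measurable_inr_image; exact: mpinr.
  + exact: measurableX.
  + by move=> _ [/= [x S1x <-] [y S2y <-]].
- by rewrite betaN; apply: hallE; exact: mpinl.
- by exists mu; split.
Qed.
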